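(* For every proposition $\phi$: $\vDash 0\leqslant\phi$ if and only if $\Vdash-\frac1n\leqslant\phi$ for all integers $n\geqslant1$.
   Context: Syntax. Fix a countable set $\mathbb P$ of atomic propositions. (Affine) propositions are built inductively: $1$, every $p\in\mathbb P$, $\phi+\psi$, $r\phi$ ($r\in\mathbb R$), $\Box\phi$. Abbreviations: a real number $r$ used as a proposition means $r1$ (so $0$ is $0\cdot 1$); $-\phi$ is $(-1)\phi$; $\phi-\psi$ is $\phi+(-1)\psi$. A condition is an expression $\phi\leqslant\psi$ with $\phi,\psi$ propositions; $\phi=\psi$ stands for the two conditions $\phi\leqslant\psi$, $\psi\leqslant\phi$. Proof system. Logical axioms (for all propositions $\phi,\psi,\theta$ and reals $r,s$): (A1) $r\leqslant s$, whenever $r\leqslant s$ holds in $\mathbb R$; (A2) $\phi+(\psi+\theta)=(\phi+\psi)+\theta$; (A3) $\phi+\psi=\psi+\phi$; (A4) $0+\phi=\phi$; (A5) $r(\phi+\psi)=r\phi+r\psi$; (A6) $(r+s)\phi=r\phi+s\phi$; (A7) $r(s\phi)=(rs)\phi$; (A8) $1\phi=\phi$; (A9) $0\phi=0$; (A10) $0\leqslant p$ and $p\leqslant 1$ for $p\in\mathbb P$; (A11) $\Box(\phi-\psi)\leqslant\Box\phi-\Box\psi$; (A12) $\Box\phi\leqslant\phi$; (A13) $\Box\phi\leqslant\Box\Box\phi$; (A14) $\Box(r\phi)=r\Box\phi$ for $r\geqslant0$; (A15) $\Box r=r$. Rules: (R1) from $\phi\leqslant\psi$ infer $\phi+\theta\leqslant\psi+\theta$;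 (R2) from $0\leqslant r$ and $\phi\leqslant\psi$ infer $r\phi\leqslant r\psi$; (R3) from $\phi\leqslant\psi$ and $\psi\leqslant\theta$ infer $\phi\leqslant\theta$; (R4) from $\phi\leqslant\psi$ infer $\Box\phi\leqslant\Box\psi$. $\Vdash\mathcal S$ means that the condition $\mathcal S$ is derivable from the logical axioms by finitely many applications of (R1)-(R4). Semantics. A topological model is a pair $M=(X,\mathbf v)$ with $X$ a topological space and $\mathbf v$ assigning to each $p\in\mathbb P$ an arbitrary map $\mathbf v_p:X\to[0,1]$. The value $\phi^M:X\to\mathbb R$ is defined by $1^M(x)=1$, $p^M(x)=\mathbf v_p(x)$, $(\phi+\psi)^M=\phi^M+\psi^M$, $(r\phi)^M=r\phi^M$, and $(\Box\phi)^M(x)=\sup\{\inf_{t\in U}\phi^M(t): U\ni x \text{ open}\}$ (the lower semi-continuous envelope of $\phi^M$). $\vDash\phi\leqslant\psi$ means: $\phi^M(x)\leqslant\psi^M(x)$ for every topological model $M=(X,\mathbf v)$ and every $x\in X$. *)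

(* Defs.v *)
From HB Require Import structures.
From mathcomp Require Import all_boot all_order all_algebra.
From mathcomp Require Import boolp classical_sets reals topology.

Set Implicit Arguments.
Unset Strict Implicit.
Unset Printing Implicit Defensive.

Import Order.TTheory GRing.Theory Num.Theory.
Local Open Scope classical_set_scope.
Local Open Scope ring_scope.

Inductive aprop (R P : Type) : Type :=
| One
| Atom of P
| Add of aprop R P & aprop R P
| Scale of R & aprop R P
| Box of aprop R P.

Arguments One {R P}.
Arguments Atom {R P} _.

Definition Const (R P : Type) (r : R) : aprop R P := Scale r One.

Arguments Const {R P} r.

Definition Minus (R : realType) (P : Type) (phi psi : aprop R P) : aprop R P :=
  Add phi (Scale (-1) psi).

Record condition (R P : Type) : Type := Leq { lhs : aprop R P; rhs : aprop R P }.

Declare Scope aprop_scope.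
Delimit Scope aprop_scope with A.
Bind Scope aprop_scope with aprop.
Bind Scope aprop_scope with condition.

Notation "phi + psi" := (Add phi psi) : aprop_scope.
Notation "phi - psi" := (Minus phi psi) : aprop_scope.
Notation "r *: phi" := (Scale r%R phi) : aprop_scope.
Notation "phi <= psi" := (Leq phi psi) : aprop_scope.

Section Derivability.
Context {R : realType} {P : Type}.
Implicit Types (phi psi theta : aprop R P) (r s : R) (p : P) (S : condition R P).

(* The logical axioms that are equations phi = psi; [logical_axiom] below takes both
   conditions phi <= psi and psi <= phi for each of them. *)
Inductive eq_axiom : aprop R P -> aprop R P -> Prop :=
| ax_addA phi psi theta :
    eq_axiom (phi + (psi + theta)) ((phi + psi) + theta)
| ax_addC phi psi : eq_axiom (phi + psi) (psi + phi)
| ax_add0 phi : eq_axiom (Const 0 + phi) phi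
| ax_scaleDr r phi psi : eq_axiom (r *: (phi + psi)) (r *: phi + r *: psi)
| ax_scaleDl r s phi : eq_axiom ((r + s) *: phi) (r *: phi + s *: phi)
| ax_scaleA r s phi : eq_axiom (r *: (s *: phi)) ((r * s) *: phi)
| ax_scale1 phi : eq_axiom (1 *: phi) phi
| ax_scale0 phi : eq_axiom (0 *: phi) (Const 0)
| ax_boxZ r phi : 0 <= r -> eq_axiom (Box (r *: phi)) (r *: Box phi)
| ax_box_const r : eq_axiom (Box (Const r)) (Const r).

Inductive logical_axiom : condition R P -> Prop :=
| ax_const r s : r <= s -> logical_axiom (Const r <= Const s)
| ax_eq_le phi psi : eq_axiom phi psi -> logical_axiom (phi <= psi)
| ax_eq_ge phi psi : eq_axiom phi psi -> logical_axiom (psi <= phi)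
| ax_atom_ge0 p : logical_axiom (Const 0 <= Atom p)
| ax_atom_le1 p : logical_axiom (Atom p <= One)
| ax_boxB phi psi : logical_axiom (Box (phi - psi) <= Box phi - Box psi)
| ax_boxT phi : logical_axiom (Box phi <= phi)
| ax_box4 phi : logical_axiom (Box phi <= Box (Box phi)).

Inductive derivable : condition R P -> Prop :=
| der_axiom S : logical_axiom S -> derivable S
| der_add phi psi theta :
    derivable (phi <= psi) -> derivable (phi + theta <= psi + theta)
| der_scale r phi psi :
    derivable (Const 0 <= Const r) -> derivable (phi <= psi) ->
    derivable (r *: phi <= r *: psi)
| der_trans phi psi theta :
    derivable (phi <= psi) -> derivable (psi <= theta) ->
    derivable (phi <= theta)
| der_box phi psi :
    derivable (phi <= psi) -> derivable (Box phi <= Box psi).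

End Derivability.

Record topModel (R : realType) (P : Type) := TopModel {
  space :> topologicalType;
  valuation : P -> space -> R;
  valuation01 : forall p x, 0 <= valuation p x <= 1
}.

(* [sup] and [inf] are the real-valued ones. They are the true supremum and
   infimum whenever f is bounded, which the value of a proposition always is. *)
Definition lsc_envelope (R : realType) (X : topologicalType) (f : X -> R)
    (x : X) : R :=
  sup [set inf (f @` U) | U in [set U : set X | open U /\ U x]].

Section Value.
Context {R : realType} {P : Type} (M : topModel R P).

Fixpoint value (phi : aprop R P) : M -> R :=
  match phi with
  | One => fun=> 1
  | Atom p => valuation p
  | Add phi psi => fun x => (value phi x + value psi x)%R
  | Scale r phi => fun x => (r * value phi x)%R
  | Box phi => lsc_envelope (value phi)
  end.

End Value.

Arguments value {R P} M phi x.

Definition valid (R : realType) (P : Type) (S : condition R P) : Prop :=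
  forall (M : topModel R P) (x : M), value M (lhs S) x <= value M (rhs S) x.

(* Main.v *)
Require Import Defs.
From Corelib Require Setoid.
From HB Require Import structures.
From mathcomp Require Import all_boot all_order all_algebra.
From mathcomp Require Import unstable boolp classical_sets reals topology.
From mathcomp Require Import ring lra.

(** Soundness holds because the lower semi-continuous envelope satisfies every
    axiom on [Box] ([derivable_valid]); letting [n] grow then turns the
    derivable bounds [- 1/n <= phi] into [0 <= phi] in every model.

    For completeness, call state a monotone linear functional on propositions
    with value [1] on [One]. Propositions modulo derivable equality form an
    ordered vector space in which [One] is an order unit, so a proposition
    outside a proper convex cone is separated from it by a state
    ([state_separation]). If [- r <= phi] is not derivable for some [r > 0],
    separating [phi + r] from the cone of derivably nonnegative propositions
    gives a state [g] with [g phi <= - r < 0]. The states thus refute [0 <= phi], once they are made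
    into a model in which the value of every proposition [phi] at the state [f]
    is [f phi] ([canonical_value]).

    The topology that does it is the Alexandrov topology of the preorder
    [f <= g] iff [f (Box psi) <= g (Box psi)] for all [psi]: the open sets are
    the up-sets, so the envelope of [g |-> g phi] at [f] is its infimum over the
    states [g] above [f]. This infimum is at least [f (Box phi)] because
    [f (Box phi) <= g (Box phi) <= g phi]. It is not larger: the propositions
    [psi] with [0 <= f (Box psi)] form a proper cone, by the axioms on [Box],
    and for [f (Box phi) < r] a state [g] that separates [phi - r] from this
    cone satisfies [g phi <= r] and, as the cone contains all
    [Box psi - f (Box psi)], lies above [f] ([box_witness]). *)

Set Implicit Arguments.
Unset Strict Implicit.
Unset Printing Implicit Defensive.

Import Order.TTheory GRing.Theory Num.Theory.
Import Defs.
Local Open Scope classical_set_scope.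
Local Open Scope ring_scope.

(** * The lower semi-continuous envelope and soundness *)

Section Envelope.
Context {R : realType} {X : topologicalType}.
Implicit Types (f g : X -> R) (U : set X) (x : X) (c r : R).

(** The real-valued supremum and infimum are the true ones only for bounded
    functions; the laws of the envelope are therefore stated for these. *)
Definition has_bound f := exists c, forall x, `|f x| <= c.

Lemma inf_image_le f U x : has_bound f -> U x -> inf (f @` U) <= f x.
Proof.
move=> [c fc] Ux; apply: ge_inf; last by exists x.
by exists (- c) => _ [y _ <-]; have := fc y; rewrite ler_norml => /andP[].
Qed.

(** This lemma and the next one describe the numbers below the envelope by open
    neighbourhoods; the laws of the envelope follow from them without further
    use of suprema and infima. *)
Lemma envelope_ge f U x c : has_bound f -> open U -> U x ->
  (forall t, U t -> c <= f t) -> c <= lsc_envelope f x.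
Proof.
move=> bf oU Ux cf; apply: (@le_trans _ _ (inf (f @` U))).
  by apply: lb_le_inf => [|_ [y Uy <-]]; [exists (f x), x | exact: cf].
apply: ub_le_sup; last by exists U.
by exists (f x) => _ [V [_ Vx] <-]; exact: inf_image_le.
Qed.

Lemma envelope_gt f x c : has_bound f -> c < lsc_envelope f x ->
  exists U, [/\ open U, U x & forall t, U t -> c <= f t].
Proof.
move=> bf /sup_gt[|_ [U [oU Ux] <-] cU].
  by exists (inf (f @` setT)), setT => //; split=> //; exact: openT.
exists U; split=> // t Ut; apply: le_trans (ltW cU) _.
exact: inf_image_le.
Qed.

Lemma envelope_le f x : has_bound f -> lsc_envelope f x <= f x.
Proof. by move=> bf; apply/ler_ltP => c /(envelope_gt bf)[U [_ Ux]]; apply. Qed.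

Lemma envelope_mono f g x : has_bound f -> has_bound g ->
  (forall t, f t <= g t) -> lsc_envelope f x <= lsc_envelope g x.
Proof.
move=> bf bg fg; apply/ler_ltP => c /(envelope_gt bf)[U [oU Ux cf]].
by apply: (envelope_ge bg oU Ux) => t Ut; exact: le_trans (cf t Ut) (fg t).
Qed.

Lemma has_bound_cst r : has_bound (fun=> r).
Proof. by exists `|r|. Qed.

Lemma has_boundD f g : has_bound f -> has_bound g ->
  has_bound (fun x => f x + g x).
Proof.
move=> [c fc] [d gd]; exists (c + d) => x.
by apply: le_trans (ler_normD _ _) _; exact: lerD.
Qed.

Lemma has_boundZ r f : has_bound f -> has_bound (fun x => r * f x).
Proof.
by move=> [c fc]; exists (`|r| * c) => x; rewrite normrM ler_wpM2l.
Qed.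

Lemma has_bound_envelope f : has_bound f -> has_bound (lsc_envelope f).
Proof.
move=> bf; have [c fc] := bf; exists c => x.
have cf t : - c <= f t <= c by rewrite -ler_norml.
rewrite ler_norml (envelope_ge bf openT) //=; last first.
  by move=> t _; case/andP: (cf t).
by apply: le_trans (envelope_le _ bf) _; case/andP: (cf x).
Qed.

Lemma envelope_cst r x : lsc_envelope (fun=> r) x = r.
Proof.
apply/eqP; rewrite eq_le envelope_le /=; last exact: has_bound_cst.
by apply: (envelope_ge (has_bound_cst r) openT).
Qed.

Lemma envelopeD_ge f g x : has_bound f -> has_bound g ->
  lsc_envelope f x + lsc_envelope g x <= lsc_envelope (fun t => f t + g t) x.
Proof.
move=> bf bg; rewrite -lerBrDr.
apply/ler_ltP => c /(envelope_gt bf)[U [oU Ux cU]].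
rewrite lerBrDr addrC -lerBrDr.
apply/ler_ltP => d /(envelope_gt bg)[V [oV Vx dV]].
rewrite lerBrDr; apply: (envelope_ge (has_boundD bf bg) (openI oU oV)) => //.
by move=> t [Ut Vt]; rewrite addrC lerD ?cU ?dV.
Qed.

Lemma envelope_idem_ge f x : has_bound f ->
  lsc_envelope f x <= lsc_envelope (lsc_envelope f) x.
Proof.
move=> bf; apply/ler_ltP => c /(envelope_gt bf)[U [oU Ux cf]].
apply: (envelope_ge (has_bound_envelope bf) oU Ux) => t Ut.
exact: (envelope_ge bf oU Ut).
Qed.

Lemma envelopeZ_ge r f x : has_bound f -> 0 < r ->
  r * lsc_envelope f x <= lsc_envelope (fun t => r * f t) x.
Proof.
move=> bf r0; rewrite mulrC -ler_pdivlMr //.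
apply/ler_ltP => c /(envelope_gt bf)[U [oU Ux cf]].
rewrite ler_pdivlMr //; apply: (envelope_ge (has_boundZ r bf) oU Ux) => t Ut.
by rewrite mulrC ler_pM2l // cf.
Qed.

Lemma envelopeZ r f x : has_bound f -> 0 <= r ->
  lsc_envelope (fun t => r * f t) x = r * lsc_envelope f x.
Proof.
move=> bf; rewrite le_eqVlt => /predU1P[<-|r0].
  under eq_fun do rewrite mul0r.
  by rewrite envelope_cst mul0r.
apply/eqP; rewrite eq_le envelopeZ_ge // andbT mulrC -ler_pdivrMr // mulrC.
apply: le_trans (envelopeZ_ge x (has_boundZ r bf) _) _.
  by rewrite invr_gt0.
under eq_fun do rewrite mulKf ?gt_eqF //.
by [].
Qed.

End Envelope.

Section Soundness.
Context {R : realType} {P : Type}.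
Implicit Types (phi psi : aprop R P) (M : topModel R P).

Lemma has_bound_value M phi : has_bound (value M phi).
Proof.
elim: phi => [|p|phi bphi psi bpsi|r phi bphi|phi bphi] /=.
- exact: has_bound_cst.
- by exists 1 => x; have /andP[v0 v1] := valuation01 p x; rewrite ger0_norm.
- exact: has_boundD.
- exact: has_boundZ.
- exact: has_bound_envelope.
Qed.

Lemma eq_axiom_value M phi psi : eq_axiom phi psi -> value M phi = value M psi.
Proof.
case=> *; apply/funext => x /=; rewrite ?envelope_cst ?envelopeZ //; try ring.
exact: has_bound_value.
Qed.

Lemma logical_axiom_valid (S : condition R P) : logical_axiom S -> valid S.
Proof.
case=> [r s rs|phi psi E|phi psi E|p|p|phi psi|phi|phi] M x /=.
- by rewrite !mulr1.
- by rewrite (eq_axiom_value M E).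
- by rewrite (eq_axiom_value M E).
- by rewrite mul0r; case/andP: (valuation01 p x).
- by case/andP: (valuation01 p x).
- have bd := has_boundD (has_bound_value M phi)
    (has_boundZ (-1) (has_bound_value M psi)).
  rewrite mulN1r lerBrDr.
  apply: le_trans (envelopeD_ge _ bd (has_bound_value M psi)) _.
  by under eq_fun do rewrite mulN1r subrK.
- exact/envelope_le/has_bound_value.
- exact/envelope_idem_ge/has_bound_value.
Qed.

Lemma derivable_valid (S : condition R P) : derivable S -> valid S.
Proof.
elim=> {S} [S /logical_axiom_valid//|phi psi theta _ IH|r phi psi _ r0 _ IH
  |phi psi theta _ IH1 _ IH2|phi psi _ IH] M x /=.
- by rewrite lerD2r; exact: IH.
- by rewrite ler_wpM2l ?IH //; have := r0 M x; rewrite /= mul0r mulr1.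
- exact: le_trans (IH1 M x) (IH2 M x).
- by apply: envelope_mono; [exact: has_bound_value..|exact: IH].
Qed.

End Soundness.

(** * Linear identities are derivable *)

Section Linear.
Context {R : realType} {P : Type}.
Implicit Types (phi psi theta a : aprop R P) (r : R) (s : seq (aprop R P)).

HB.instance Definition _ := gen_eqMixin (aprop R P).

Definition equiderivable phi psi :=
  derivable (phi <= psi)%A /\ derivable (psi <= phi)%A.

Local Notation "phi =~ psi" := (equiderivable phi psi) (at level 70).

Lemma eq_axiom_equiderivable phi psi : eq_axiom phi psi -> phi =~ psi.
Proof.
by move=> E; split; apply: der_axiom; [exact: ax_eq_le|exact: ax_eq_ge].
Qed.

Lemma derivable_refl phi : derivable (phi <= phi)%A.
Proof.
have [le1 ge1] := eq_axiom_equiderivable (ax_scale1 phi).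
exact: der_trans ge1 le1.
Qed.

#[local] Instance equiderivable_equivalence :
  RelationClasses.Equivalence equiderivable.
Proof.
split=> [phi|phi psi [le ge]|phi psi theta [le1 ge1] [le2 ge2]].
- by split; exact: derivable_refl.
- by split.
- by split; [exact: der_trans le1 le2|exact: der_trans ge2 ge1].
Qed.

Lemma derivable_addl theta phi psi :
  derivable (phi <= psi)%A -> derivable (theta + phi <= theta + psi)%A.
Proof.
have [C1 _] := eq_axiom_equiderivable (ax_addC theta phi).
have [C2 _] := eq_axiom_equiderivable (ax_addC psi theta).
by move=> /(der_add theta) D; exact: der_trans C1 (der_trans D C2).
Qed.

#[local] Instance Add_proper :
  Morphisms.Proper (Morphisms.respectful equiderivable
    (Morphisms.respectful equiderivable equiderivable)) (@Add R P).
Proof.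
move=> phi phi' [h1 h2] psi psi' [h3 h4]; split.
  exact: der_trans (der_add _ h1) (derivable_addl _ h3).
exact: der_trans (der_add _ h2) (derivable_addl _ h4).
Qed.

Lemma derivable_scale r phi psi : 0 <= r ->
  derivable (phi <= psi)%A -> derivable (r *: phi <= r *: psi)%A.
Proof. by move=> r0; apply: der_scale; apply: der_axiom; exact: ax_const. Qed.

Lemma scaleN_cancel r phi psi : ((- r) *: phi + (r *: phi + psi))%A =~ psi.
Proof.
rewrite (eq_axiom_equiderivable (ax_addA _ _ _)).
rewrite -(eq_axiom_equiderivable (ax_scaleDl _ _ _)) addNr.
rewrite (eq_axiom_equiderivable (ax_scale0 _)).
exact/eq_axiom_equiderivable/ax_add0.
Qed.

(** The rule for scaling covers nonnegative scalars only; for a negative [r] one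
    scales by [- r] and adds [r *: phi + r *: psi] to both sides. *)
Lemma derivable_scale_le0 r phi psi : r <= 0 ->
  derivable (phi <= psi)%A -> derivable (r *: psi <= r *: phi)%A.
Proof.
rewrite -oppr_ge0 => r0 /(derivable_scale r0).
move=> /(der_add (r *: phi + r *: psi)%A) D.
have [_ D1] := scaleN_cancel r phi (r *: psi)%A.
apply: (der_trans D1 (der_trans D _)).
suff [] : ((- r) *: psi + (r *: phi + r *: psi))%A =~ (r *: phi)%A by [].
rewrite (eq_axiom_equiderivable (ax_addC (r *: phi)%A _)).
exact: scaleN_cancel.
Qed.

#[local] Instance Scale_proper r :
  Morphisms.Proper (Morphisms.respectful equiderivable equiderivable)
    (@Scale R P r).
Proof.
move=> phi psi [h1 h2]; have [r0|/ltW r0] := leP 0 r.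
  by split; exact: derivable_scale.
by split; exact: derivable_scale_le0.
Qed.

(** The coefficient of [a] when [phi] is seen as a formal linear combination of
    propositions that are [One], atoms or boxed. *)
Fixpoint coef a phi : R :=
  match phi with
  | Add phi1 phi2 => coef a phi1 + coef a phi2
  | Scale r phi1 => r * coef a phi1
  | b => (a == b)%:R
  end.

Fixpoint support phi : seq (aprop R P) :=
  match phi with
  | Add phi1 phi2 => support phi1 ++ support phi2
  | Scale _ phi1 => support phi1
  | b => [:: b]
  end.

Definition comb s (c : aprop R P -> R) : aprop R P :=
  foldr (fun a t => c a *: a + t)%A (Const 0) s.

Lemma scale_const0 r : Const 0 =~ (r *: Const 0 : aprop R P)%A.
Proof.
rewrite (eq_axiom_equiderivable (ax_scaleA _ _ _)) mulr0; reflexivity.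
Qed.

Lemma combD s c d : comb s (fun a => c a + d a) =~ (comb s c + comb s d)%A.
Proof.
elim: s => [|a s IH] /=.
  by symmetry; exact/eq_axiom_equiderivable/ax_add0.
rewrite IH (eq_axiom_equiderivable (ax_scaleDl _ _ _)).
rewrite -(eq_axiom_equiderivable (ax_addA _ _ (comb s c + _)%A)).
rewrite -(eq_axiom_equiderivable (ax_addA _ _ (_ + comb s d)%A)).
rewrite !(eq_axiom_equiderivable (ax_addA _ _ (comb s d))).
rewrite (eq_axiom_equiderivable (ax_addC (d a *: a)%A _)).
reflexivity.
Qed.

Lemma combZ s c r : comb s (fun a => r * c a) =~ (r *: comb s c)%A.
Proof.
elim: s => [|a s IH] /=; first exact: scale_const0.
rewrite IH (eq_axiom_equiderivable (ax_scaleDr _ _ _)).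
by rewrite (eq_axiom_equiderivable (ax_scaleA _ _ _)); reflexivity.
Qed.

Lemma comb0 s a : a \notin s -> comb s (fun b => (b == a)%:R) =~ Const 0.
Proof.
elim: s => [|b s IH] /=; first by reflexivity.
rewrite inE negb_or eq_sym => /andP[/negbTE-> /IH ->].
rewrite (eq_axiom_equiderivable (ax_scale0 _)).
exact/eq_axiom_equiderivable/ax_add0.
Qed.

Lemma comb1 s a : uniq s -> a \in s -> comb s (fun b => (b == a)%:R) =~ a.
Proof.
elim: s => [//|b s IH] /= /andP[bs us]; rewrite inE => /predU1P[->|as_].
  rewrite eqxx comb0 // (eq_axiom_equiderivable (ax_scale1 _)).
  rewrite (eq_axiom_equiderivable (ax_addC _ _)).
  exact/eq_axiom_equiderivable/ax_add0.
rewrite IH //; have [ba|_] := eqVneq b a; first by rewrite ba as_ in bs.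
rewrite (eq_axiom_equiderivable (ax_scale0 _)).
exact/eq_axiom_equiderivable/ax_add0.
Qed.

(** Induction on [phi] over a fixed list [s]: as both sides are then linear in
    [phi], only the combinations with a single coefficient remain. *)
Lemma comb_coef s phi : uniq s -> {subset support phi <= s} ->
  comb s (coef^~ phi) =~ phi.
Proof.
move=> us; elim: phi => [|p|phi IH1 psi IH2|r phi IH|phi _] /= sub.
- by apply: comb1 => //; apply: sub; rewrite inE.
- by apply: comb1 => //; apply: sub; rewrite inE.
- rewrite combD IH1 ?IH2; first by reflexivity.
    by move=> b bs; apply: sub; rewrite mem_cat bs orbT.
  by move=> b bs; apply: sub; rewrite mem_cat bs.
- by rewrite combZ IH //; reflexivity.
- by apply: comb1 => //; apply: sub; rewrite inE.
Qed.

Definition linear_form (h : aprop R P -> R) :=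
  ((forall phi psi, h (phi + psi)%A = (h phi + h psi)%R) *
   (forall r phi, h (r *: phi)%A = (r * h phi)%R))%type.

(** This turns the verification of a linear identity between propositions into
    one between real numbers: the coefficients are linear forms, and a
    proposition is equiderivable with the combination of its support that they
    define. *)
Lemma linear_ext phi psi : (forall h, linear_form h -> h phi = h psi) ->
  phi =~ psi.
Proof.
move=> E; pose s := undup (support phi ++ support psi).
rewrite -(@comb_coef s phi) ?undup_uniq //; last first.
  by move=> b bs; rewrite mem_undup mem_cat bs.
rewrite -[X in _ =~ X](@comb_coef s psi) ?undup_uniq //; last first.
  by move=> b bs; rewrite mem_undup mem_cat bs orbT.
rewrite (_ : coef^~ phi = coef^~ psi); first by reflexivity.
by apply/funext => a; apply: E; split.
Qed.

(** A nonnegative combination of two derivable conditions is derivable in any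
    linearly equivalent form: the difference between the form wanted and the
    combination is added to both sides by the first rule. *)
Lemma derivable_comb phi1 psi1 phi2 psi2 phi psi r1 r2 : 0 <= r1 -> 0 <= r2 ->
  derivable (phi1 <= psi1)%A -> derivable (phi2 <= psi2)%A ->
  (forall h, linear_form h ->
    h psi - h phi = r1 * (h psi1 - h phi1) + r2 * (h psi2 - h phi2)) ->
  derivable (phi <= psi)%A.
Proof.
move=> r10 r20 D1 D2 E.
pose rest := (phi - (r1 *: phi1 + r2 *: phi2))%A.
have [_ h1] : (r1 *: phi1 + r2 *: phi2 + rest)%A =~ phi.
  by apply: linear_ext => h hL; rewrite /rest /Minus !hL; ring.
have [h2 _] : (r1 *: psi1 + r2 *: psi2 + rest)%A =~ psi.
  apply: linear_ext => h hL; rewrite /rest /Minus !hL.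
  by rewrite -[RHS](subrK (h phi)) (E h hL); ring.
apply: der_trans h1 (der_trans (der_add _ _) h2).
apply: der_trans (der_add _ (derivable_scale r10 D1)) _.
exact: derivable_addl (derivable_scale r20 D2).
Qed.

Lemma derivable_le_sub phi psi :
  derivable (phi <= psi)%A -> derivable (Const 0 <= psi - phi)%A.
Proof.
move=> D; apply: (derivable_comb ler01 (lexx 0) D D) => h hL.
by rewrite /Minus /Const !hL; ring.
Qed.

Lemma derivable_const (q r : R) : q <= r ->
  derivable (Const q <= Const r : condition R P)%A.
Proof. by move=> qr; apply: der_axiom; exact: ax_const. Qed.

(** [One] is an order unit. For boxed propositions this rests on the axiom
    that [Box] fixes the constants. *)
Lemma order_unit phi : exists c : R,
  derivable (Const (- c) <= phi)%A /\ derivable (phi <= Const c)%A.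
Proof.
elim: phi => [|p|phi [c [cl cu]] psi [d [dl du]]|r phi [c [cl cu]]
  |phi [c [cl cu]]].
- have [? ?] := eq_axiom_equiderivable (ax_scale1 (One : aprop R P)).
  exists 1; split=> //.
  by apply: der_trans (derivable_const _) _; last eassumption; lra.
- have [? ?] := eq_axiom_equiderivable (ax_scale1 (One : aprop R P)).
  exists 1; split.
    apply: der_trans (der_axiom (ax_atom_ge0 p)); apply: derivable_const; lra.
  by apply: der_trans (der_axiom (ax_atom_le1 p)) _.
- exists (c + d); split.
    apply: (derivable_comb ler01 ler01 cl dl) => h hL.
    by rewrite /Const !hL; ring.
  apply: (derivable_comb ler01 ler01 cu du) => h hL.
  by rewrite /Const !hL; ring.
- have [r0|/ltW r0] := leP 0 r.
    exists (r * c); split.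
      apply: (derivable_comb r0 (lexx 0) cl cl) => h hL.
      by rewrite /Const !hL; ring.
    apply: (derivable_comb r0 (lexx 0) cu cu) => h hL.
    by rewrite /Const !hL; ring.
  rewrite -oppr_ge0 in r0; exists (- r * c); split.
    apply: (derivable_comb r0 (lexx 0) cu cu) => h hL.
    by rewrite /Const !hL; ring.
  apply: (derivable_comb r0 (lexx 0) cl cl) => h hL.
  by rewrite /Const !hL; ring.
- exists c; split.
    apply: der_trans (der_box cl).
    by have [] := eq_axiom_equiderivable (ax_box_const (P := P) (- c)).
  apply: der_trans (der_box cu) _.
  by have [] := eq_axiom_equiderivable (ax_box_const (P := P) c).
Qed.

End Linear.

(** * States and the separation of a proposition from a cone *)

Section States.
Context (R : realType) (P : Type).
Implicit Types (phi psi theta chi : aprop R P) (r : R) (K : set (aprop R P)).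

Record state := State {
  state_fun :> aprop R P -> R;
  state_linear : linear_form state_fun;
  state_One : state_fun One = 1;
  state_le : forall phi psi,
    derivable (phi <= psi)%A -> state_fun phi <= state_fun psi
}.

Record proper_cone K : Prop := ProperCone {
  cone0 : K (Const 0);
  cone_up : forall phi psi, derivable (phi <= psi)%A -> K phi -> K psi;
  coneD : forall phi psi, K phi -> K psi -> K (phi + psi)%A;
  coneZ : forall r phi, 0 <= r -> K phi -> K (r *: phi)%A;
  coneN1 : ~ K (Const (-1))
}.

(** Together with [linear_ext], the form in which membership in a cone is proved
    below: the identity to check is one between real numbers. *)
Lemma cone_comb K a b phi psi theta : proper_cone K -> 0 <= a -> 0 <= b ->
  K phi -> K psi ->
  (forall h, linear_form h -> h theta = a * h phi + b * h psi) -> K theta.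
Proof.
move=> cK a0 b0 Kphi Kpsi E.
have [D _] : equiderivable (a *: phi + b *: psi)%A theta.
  by apply: linear_ext => h hL; rewrite (E h hL) !hL.
exact: (cone_up cK D (coneD cK (coneZ cK a0 Kphi) (coneZ cK b0 Kpsi))).
Qed.

Lemma cone_const K r : proper_cone K -> K (Const r) <-> 0 <= r.
Proof.
move=> cK; split=> [Kr|r0]; last exact: cone_up (derivable_const r0) (cone0 cK).
rewrite leNgt; apply/negP => r0; apply: (coneN1 cK).
have r'0 : 0 <= - r^-1 by rewrite oppr_ge0 invr_le0 ltW.
apply: (cone_comb cK r'0 r'0 Kr (cone0 cK)) => h hL.
by rewrite /Const !hL; field; rewrite lt_eqF.
Qed.

(** The cone spanned by [K] and [- chi]. *)
Definition cone_minus K chi : set (aprop R P) :=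
  [set theta | exists2 t, 0 <= t & K (theta + t *: chi)%A].

Lemma cone_minus_sub K chi : proper_cone K -> K `<=` cone_minus K chi.
Proof.
move=> cK psi Kpsi; exists 0 => //.
apply: (cone_comb cK ler01 ler01 Kpsi (cone0 cK)) => h hL.
by rewrite /Const !hL; ring.
Qed.

Lemma cone_minus_opp K chi : proper_cone K -> cone_minus K chi (-1 *: chi)%A.
Proof.
move=> cK; exists 1 => //.
apply: (cone_comb cK ler01 ler01 (cone0 cK) (cone0 cK)) => h hL.
by rewrite /Const !hL; ring.
Qed.

(** If [-1 + t chi] were in [K] with [t > 0], then so would be [t chi], and
    [chi]; the case [t = 0] contradicts that [K] is proper. *)
Lemma proper_cone_minus K chi : proper_cone K -> ~ K chi ->
  proper_cone (cone_minus K chi).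
Proof.
move=> cK Kchi; split.
- exact: cone_minus_sub (cone0 cK).
- move=> phi psi D [t t0 Kt]; exists t => //.
  exact: cone_up (der_add _ D) Kt.
- move=> phi psi [t t0 Kt] [u u0 Ku]; exists (t + u); first exact: addr_ge0.
  by apply: (cone_comb cK ler01 ler01 Kt Ku) => h hL; rewrite !hL; ring.
- move=> r phi r0 [t t0 Kt]; exists (r * t); first exact: mulr_ge0.
  by apply: (cone_comb cK r0 ler01 Kt (cone0 cK)) => h hL;
    rewrite /Const !hL; ring.
- move=> [t]; rewrite le_eqVlt => /predU1P[<-|t0] Kt.
    apply: (coneN1 cK).
    by apply: (cone_comb cK ler01 ler01 Kt (cone0 cK)) => h hL;
      rewrite /Const !hL; ring.
  apply: Kchi; have K1 : K (Const 1) by apply/cone_const.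
  have t'0 : 0 <= t^-1 by rewrite invr_ge0 ltW.
  apply: (cone_comb cK t'0 t'0 Kt K1) => h hL.
  by rewrite /Const !hL; field; rewrite gt_eqF.
Qed.

(** A maximal proper cone [L] above [K] is total: if [chi] is not in [L], then
    [cone_minus L chi] is proper, hence equal to [L], and it contains
    [- chi]. *)
Lemma total_proper_cone K : proper_cone K -> exists2 L,
  proper_cone L & K `<=` L /\ forall chi, L chi \/ L (-1 *: chi)%A.
Proof.
move=> cK.
(* The empty chain has an empty union, which the condition must allow. *)
pose good (A : set (aprop R P)) := A !=set0 -> proper_cone A /\ K `<=` A.
have [F sF tF|L [goodL maxL]] := @Zorn_bigcup _ good.
  have goodF A phi : F A -> A phi -> proper_cone A /\ K `<=` A.
    by move=> FA Aphi; apply: (sF _ FA); exists phi.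
  move=> [phi0 [A0 FA0 A0phi0]]; have [cA0 KA0] := goodF _ _ FA0 A0phi0.
  split; last by move=> psi Kpsi; exists A0 => //; exact: KA0.
  split.
  - by exists A0 => //; exact: cone0.
  - move=> phi psi D [A FA Aphi]; exists A => //.
    exact: (cone_up (goodF _ _ FA Aphi).1 D).
  - move=> phi psi [A FA Aphi] [B FB Bpsi].
    have [AB|BA] := tF _ _ FA FB.
      exists B => //; have Bphi := AB _ Aphi.
      exact: (coneD (goodF _ _ FB Bpsi).1).
    exists A => //; have Apsi := BA _ Bpsi.
    exact: (coneD (goodF _ _ FA Aphi).1).
  - move=> r phi r0 [A FA Aphi]; exists A => //.
    exact: (coneZ (goodF _ _ FA Aphi).1).
  - by move=> [A FA AN1]; apply: (coneN1 (goodF _ _ FA AN1).1).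
have [cL KL] : proper_cone L /\ K `<=` L.
  apply: goodL; apply: contrapT => L0; apply: (maxL K); last by move=> _; split.
  split=> [psi Lpsi|KL]; first by case: L0; exists psi.
  by apply: L0; exists (Const 0); apply: KL; exact: cone0 cK.
exists L => //; split=> // chi.
have [Lchi|Lchi] := pselect (L chi); [by left|right].
have sub := @cone_minus_sub L chi cL.
apply: contrapT => LNchi; apply: (maxL (cone_minus L chi)).
  by split=> // /(_ _ (cone_minus_opp chi cL)).
by move=> _; split; [exact: proper_cone_minus|exact: subset_trans sub].
Qed.

Section TotalCone.
Variables (K : set (aprop R P)) (cK : proper_cone K).
Hypothesis totalK : forall chi, K chi \/ K (-1 *: chi)%A.

(** A total proper cone separates the constants below a proposition from those
    above it. As the order unit keeps this cut bounded, it defines a real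
    number, and this number is linear in the proposition. *)
Definition cone_fun phi : R := sup [set r | K (phi - Const r)%A].

Lemma cone_const_le phi r s :
  K (phi - Const r)%A -> K (Const s - phi)%A -> r <= s.
Proof.
move=> Kr Ks; rewrite -subr_ge0; apply/(cone_const _ cK).
by apply: (cone_comb cK ler01 ler01 Kr Ks) => h hL;
  rewrite /Minus /Const !hL; ring.
Qed.

Lemma cone_fun_has_sup phi : has_sup [set r | K (phi - Const r)%A].
Proof.
have Kder psi : derivable (Const 0 <= psi)%A -> K psi.
  by move=> D; exact: cone_up D (cone0 cK).
have [c [cl cu]] := order_unit phi; split.
  by exists (- c); exact/Kder/derivable_le_sub.
by exists c => r Kr; apply: (cone_const_le Kr); exact/Kder/derivable_le_sub.
Qed.

Lemma cone_fun_gt phi r : r < cone_fun phi -> K (phi - Const r)%A.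
Proof.
move=> /sup_gt[|s Ks]; first by have [] := cone_fun_has_sup phi.
rewrite -subr_gt0 => /ltW /(cone_const _ cK) Kd.
by apply: (cone_comb cK ler01 ler01 Ks Kd) => h hL;
  rewrite /Minus /Const !hL; ring.
Qed.

Lemma cone_fun_ge phi r : K (phi - Const r)%A -> r <= cone_fun phi.
Proof.
by move=> Kr; apply: ub_le_sup => //; have [] := cone_fun_has_sup phi.
Qed.

Lemma cone_fun_lt phi r : cone_fun phi < r -> K (Const r - phi)%A.
Proof.
move=> lt_r; have [/cone_fun_ge|Kr] := totalK (phi - Const r)%A.
  by rewrite leNgt lt_r.
by apply: (cone_comb cK ler01 (lexx 0) Kr Kr) => h hL;
  rewrite /Minus /Const !hL; ring.
Qed.

(** Strict inequalities suffice to identify the cut, so that the linearity of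
    [cone_fun] can be checked without knowing whether the boundary value itself
    belongs to it. *)
Lemma cone_fun_eq phi c : (forall r, r < c -> K (phi - Const r)%A) ->
  (forall r, c < r -> K (Const r - phi)%A) -> cone_fun phi = c.
Proof.
move=> lo up; apply/eqP; rewrite eq_le; apply/andP; split.
  apply/ler_gtP => s cs; apply/ler_ltP => r /cone_fun_gt Kr.
  exact: cone_const_le Kr (up _ cs).
by apply/ler_ltP => r /lo; exact: cone_fun_ge.
Qed.

Lemma cone_funD phi psi :
  cone_fun (phi + psi)%A = cone_fun phi + cone_fun psi.
Proof.
apply: cone_fun_eq => r lt_r.
  (* Since [r - cone_fun psi < cone_fun phi], the midpoint [m] splits [r] into
     [m < cone_fun phi] and [r - m < cone_fun psi]. *)
  pose m := (cone_fun phi + (r - cone_fun psi)) / 2.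
  have Km : K (phi - Const m)%A by apply: cone_fun_gt; rewrite /m; lra.
  have Kn : K (psi - Const (r - m)%R)%A by apply: cone_fun_gt; rewrite /m; lra.
  by apply: (cone_comb cK ler01 ler01 Km Kn) => h hL;
    rewrite /Minus /Const !hL; ring.
pose m := (cone_fun phi + (r - cone_fun psi)) / 2.
have Km : K (Const m - phi)%A by apply: cone_fun_lt; rewrite /m; lra.
have Kn : K (Const (r - m)%R - psi)%A by apply: cone_fun_lt; rewrite /m; lra.
by apply: (cone_comb cK ler01 ler01 Km Kn) => h hL;
  rewrite /Minus /Const !hL; ring.
Qed.

Lemma cone_fun_const r : cone_fun (Const r) = r.
Proof.
apply: cone_fun_eq => s; rewrite -subr_gt0 => /ltW /(cone_const _ cK) Kd;
  by apply: (cone_comb cK ler01 (lexx 0) Kd Kd) => h hL;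
    rewrite /Minus /Const !hL; ring.
Qed.

Lemma cone_funZ a phi : cone_fun (a *: phi)%A = a * cone_fun phi.
Proof.
have [a0|a0|->] := ltgtP a 0.
- have a'0 : 0 <= - a by rewrite oppr_ge0 ltW.
  apply: cone_fun_eq => r; rewrite mulrC.
    rewrite -ltr_ndivlMr // => /cone_fun_lt Kr.
    apply: (cone_comb cK a'0 (lexx 0) Kr Kr) => h hL; rewrite /Minus /Const !hL.
    by field; rewrite lt_eqF.
  rewrite -ltr_ndivrMr // => /cone_fun_gt Kr.
  apply: (cone_comb cK a'0 (lexx 0) Kr Kr) => h hL; rewrite /Minus /Const !hL.
  by field; rewrite lt_eqF.
- apply: cone_fun_eq => r; rewrite mulrC.
    rewrite -ltr_pdivrMr // => /cone_fun_gt Kr.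
    apply: (cone_comb cK (ltW a0) (lexx 0) Kr Kr) => h hL;
      rewrite /Minus /Const !hL.
    by field; rewrite gt_eqF.
  rewrite -ltr_pdivlMr // => /cone_fun_lt Kr.
  apply: (cone_comb cK (ltW a0) (lexx 0) Kr Kr) => h hL;
    rewrite /Minus /Const !hL.
  by field; rewrite gt_eqF.
- rewrite mul0r -[RHS](cone_fun_const 0).
  have E r : K (0 *: phi - Const r)%A <-> K (Const 0 - Const r)%A.
    split=> Kr; apply: (cone_comb cK ler01 (lexx 0) Kr Kr) => h hL;
      by rewrite /Minus /Const !hL; ring.
  by congr sup; apply/seteqP; split=> r /= /E.
Qed.

Lemma cone_fun_le phi psi :
  derivable (phi <= psi)%A -> cone_fun phi <= cone_fun psi.
Proof.
move=> D; apply/ler_ltP => r /cone_fun_gt Kr; apply: cone_fun_ge.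
exact: cone_up (der_add _ D) Kr.
Qed.

Lemma cone_fun_One : cone_fun One = 1.
Proof.
by rewrite -[RHS](cone_fun_const 1) /Const cone_funZ mul1r.
Qed.

Definition cone_state : state :=
  State (cone_funD, cone_funZ) cone_fun_One cone_fun_le.

Lemma cone_state_ge0 phi : K phi -> 0 <= cone_state phi.
Proof.
move=> Kphi; apply: cone_fun_ge.
by apply: (cone_comb cK ler01 (lexx 0) Kphi Kphi) => h hL;
  rewrite /Minus /Const !hL; ring.
Qed.

End TotalCone.

(** Enlarging [K] by [- chi] before making it total forces the state to be at
    most [0] on [chi]. *)
Lemma state_separation K chi : proper_cone K -> ~ K chi ->
  exists2 g : state, (forall psi, K psi -> 0 <= g psi) & g chi <= 0.
Proof.
move=> cK Kchi.
have [L cL [sub tL]] := total_proper_cone (proper_cone_minus cK Kchi).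
exists (cone_state cL tL) => [psi Kpsi|].
  exact/cone_state_ge0/sub/cone_minus_sub.
have := cone_state_ge0 cL tL (sub _ (cone_minus_opp chi cK)).
by rewrite state_linear mulN1r oppr_ge0.
Qed.

Lemma state_const (f : state) r : f (Const r) = r.
Proof. by rewrite state_linear state_One mulr1. Qed.

Lemma stateB (f : state) phi psi : f (phi - psi)%A = f phi - f psi.
Proof. by rewrite !state_linear mulN1r. Qed.

End States.

(** * The canonical model *)

Section CanonicalModel.
Context (R : realType) (P : Type).
Implicit Types (phi psi : aprop R P) (f g : state R P).

Definition box_le f g := forall psi, f (Box psi) <= g (Box psi).

Definition box_upset (U : set (state R P)) :=
  forall f g, box_le f g -> U f -> U g.

Lemma box_upsetT : box_upset setT.
Proof. by []. Qed.

Lemma box_upsetI : setI_closed box_upset.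
Proof.
by move=> U V oU oV f g fg [Uf Vf]; split; [exact: oU fg Uf|exact: oV fg Vf].
Qed.

Lemma box_upset_bigcup (I : Type) (F : I -> set (state R P)) :
  (forall i, box_upset (F i)) -> box_upset (\bigcup_i F i).
Proof. by move=> oF f g fg [i _ Fif]; exists i => //; exact: oF fg Fif. Qed.

HB.instance Definition _ := gen_eqMixin (state R P).
HB.instance Definition _ := gen_choiceMixin (state R P).
HB.instance Definition _ := isOpenTopological.Build (state R P)
  box_upsetT box_upsetI box_upset_bigcup.

Lemma state_atom01 (p : P) f : 0 <= f (Atom p) <= 1.
Proof.
have := state_le f (der_axiom (ax_atom_ge0 p)).
have := state_le f (der_axiom (ax_atom_le1 p)).
by rewrite state_const state_One => -> ->.
Qed.

Definition canonical_model : topModel R P := TopModel state_atom01.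

Lemma state_box_le f phi : f (Box phi) <= f phi.
Proof. exact: state_le (der_axiom (ax_boxT phi)). Qed.

Lemma state_box_const f r : f (Box (Const r)) = r.
Proof.
have [le ge] := eq_axiom_equiderivable (ax_box_const (P := P) r).
apply/eqP; rewrite eq_le -{2}(state_const f r) -{3}(state_const f r).
by rewrite !state_le.
Qed.

Lemma state_boxZ f r phi : 0 <= r -> f (Box (r *: phi)%A) = r * f (Box phi).
Proof.
move=> r0; have [le ge] := eq_axiom_equiderivable (ax_boxZ phi r0).
by rewrite -state_linear; apply/eqP; rewrite eq_le !state_le.
Qed.

Lemma state_boxB f phi psi : f (Box (phi - psi)%A) <= f (Box phi) - f (Box psi).
Proof. by rewrite -stateB; exact: state_le (der_axiom (ax_boxB phi psi)). Qed.

(** This is axiom [ax_boxB] for [phi + psi] and [psi]. *)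
Lemma state_boxD f phi psi :
  f (Box phi) + f (Box psi) <= f (Box (phi + psi)%A).
Proof.
have [le _] : equiderivable phi (phi + psi - psi)%A.
  by apply: linear_ext => h hL; rewrite /Minus !hL; ring.
rewrite -lerBrDr; apply: le_trans (state_boxB _ _ _).
exact: state_le (der_box le).
Qed.

Definition box_cone f : set (aprop R P) := [set psi | 0 <= f (Box psi)].

Lemma proper_box_cone f : proper_cone (box_cone f).
Proof.
split; rewrite /box_cone /=.
- by rewrite state_box_const.
- by move=> phi psi D phi0; exact: le_trans (state_le f (der_box D)).
- move=> phi psi phi0 psi0; apply: le_trans (state_boxD _ _ _).
  exact: addr_ge0.
- by move=> r phi r0 phi0; rewrite state_boxZ // mulr_ge0.
- by rewrite state_box_const; apply/negP; rewrite -ltNge ltrN10.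
Qed.

(** For every [psi] the difference [Box psi - f (Box psi)] is in the cone, by
    the axiom [Box psi <= Box (Box psi)]. *)
Lemma box_le_box_cone f g :
  (forall psi, box_cone f psi -> 0 <= g psi) -> box_le f g.
Proof.
move=> fg psi; rewrite -subr_ge0 -[f _ in X in _ <= X](state_const g) -stateB.
apply: fg; rewrite /box_cone /=.
apply: le_trans (state_boxD _ _ _).
have -> : f (Box (-1 *: Const (f (Box psi)))%A) = - f (Box psi).
  rewrite -(state_box_const f (- f (Box psi))).
  have [le ge] : equiderivable (-1 *: Const (f (Box psi)) : aprop R P)%A
      (Const (- f (Box psi))).
    by apply: linear_ext => h hL; rewrite /Const !hL; ring.
  by apply/eqP; rewrite eq_le !state_le //; exact: der_box.
by rewrite subr_ge0; exact: state_le (der_axiom (ax_box4 psi)).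
Qed.

(** The analogue of the existence lemma of Kripke completeness proofs: that the
    value of [Box phi] at [f] is below [r] is witnessed by a state above [f]. *)
Lemma box_witness f phi r : f (Box phi) < r ->
  exists2 g, box_le f g & g phi <= r.
Proof.
move=> fr; have Nphi : ~ box_cone f (phi - Const r)%A.
  apply/negP; rewrite -ltNge; apply: le_lt_trans (state_boxB _ _ _) _.
  by rewrite state_box_const subr_lt0.
have [g fg g0] := state_separation (proper_box_cone f) Nphi.
exists g; first exact: box_le_box_cone.
by rewrite -subr_le0 -[r in X in X <= _](state_const g) -stateB.
Qed.

(** On [Box phi], the up-set of [f] is an open set on which [phi] is at least
    [f (Box phi)], and every open set around [f] contains the states given by
    [box_witness]. *)
Lemma canonical_value phi : value canonical_model phi = fun f => f phi.
Proof.
apply/funext => f; elim: phi f => [|p|phi IH1 psi IH2|r phi IH|phi IH] f /=.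
- by rewrite state_One.
- by [].
- by rewrite IH1 IH2 state_linear.
- by rewrite IH state_linear.
have bphi := has_bound_value canonical_model phi.
apply/eqP; rewrite eq_le; apply/andP; split.
  apply/ler_gtP => r /box_witness[g fg gr].
  apply/ler_ltP => c /(envelope_gt bphi)[U [oU Uf cU]].
  by apply: le_trans (cU g (oU _ _ fg Uf)) _; rewrite IH.
apply: (@envelope_ge _ _ _ [set g | box_le f g]) => //.
- by move=> g h gh fg psi; exact: le_trans (fg psi) (gh psi).
- by move=> g fg; rewrite IH; exact: le_trans (fg phi) (state_box_le g phi).
Qed.

End CanonicalModel.

Lemma valid_derivable (R : realType) (P : Type) (phi : aprop R P) (r : R) :
  valid (Const 0 <= phi)%A -> 0 < r -> derivable (Const (- r) <= phi)%A.
Proof.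
move=> val r0; apply: contrapT => Nder.
have NphiN : ~ derivable (Const 0 <= phi - Const (- r))%A.
  move=> D; apply: Nder; apply: (derivable_comb ler01 (lexx 0) D D) => h hL.
  by rewrite /Minus /Const !hL; ring.
have cK : proper_cone [set psi : aprop R P | derivable (Const 0 <= psi)%A].
  split=> /=.
  - exact: derivable_refl.
  - by move=> psi theta D D0; exact: der_trans D0 D.
  - move=> psi theta D1 D2; apply: (derivable_comb ler01 ler01 D1 D2) => h hL.
    by rewrite /Const !hL; ring.
  - move=> s psi s0 D; apply: (derivable_comb s0 (lexx 0) D D) => h hL.
    by rewrite /Const !hL; ring.
  (* From [0 <= -1] everything follows, since [One] is an order unit. *)
  - move=> DN1; apply: Nder; have [c [cphi _]] := order_unit phi.
    have [cr|/ltW] := leP c r.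
      by apply: der_trans (derivable_const _) cphi; rewrite lerN2.
    rewrite -subr_ge0 => rc; apply: (derivable_comb ler01 rc cphi DN1) => h hL.
    by rewrite /Const !hL; ring.
have [g _] := state_separation cK NphiN.
have := val (canonical_model R P) g.
rewrite !canonical_value stateB !state_const; lra.
Qed.

Theorem theorem4p5 (R : realType) (P : countType) (phi : aprop R P) :
  valid (Const 0 <= phi)%A <->
  (forall n : nat, (1 <= n)%N -> derivable (Const (- (1 / n%:R)) <= phi)%A).
Proof.
split=> [val n n1|der M x].
  by apply: valid_derivable => //; rewrite divr_gt0 ?ltr0n.
rewrite /= mul0r; apply/ler_addgt0Pr => e e0.
have [n [n1 ne]] : exists n : nat, (1 <= n)%N /\ 1 / n%:R <= e :> R.
  exists (Num.truncn e^-1).+1; split=> //.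
  rewrite div1r invf_ple ?posrE ?ltr0n //.
  by apply/ltW; rewrite truncnS_gt.
have := derivable_valid (der n n1) x; rewrite /= mulr1; lra.
Qed.
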